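(* Let $\lambda<\mu$, where $\lambda$ is an infinite cardinal and $\mu$ is a cardinal or $\infty$. Let $\mathfrak{k}=(K_{\mathfrak k},\le_{\mathfrak k})$ be an essentially $[\lambda,\mu)$-a.e.c. (ess-$[\lambda,\mu)$-a.e.c.) and let $\mathbb{E}$ be a small smooth $\mathfrak{k}$-equivalence relation. Let $\mathfrak{k}\langle\mathbb{E}\rangle$ be the class with ordering defined in the context. (1) $\mathfrak{k}\langle\mathbb{E}\rangle$ is an ess-$[\lambda,\mu)$-a.e.c. (2) If $\mathfrak{k}$ has the amalgamation property, then $\mathfrak{k}\langle\mathbb{E}\rangle$ has the amalgamation property.
   Context: **Ess-$[\lambda,\mu)$-a.e.c.** This is an object $\mathfrak{k}$ consisting of a vocabulary $\tau=\tau_{\mathfrak k}$ whose predicates and function symbols have possibly infinite arity, but arity $\le\lambda$; a class $K=K_{\mathfrak k}$ of $\tau$-models; and a two-place relation $\le_{\mathfrak k}$ on $K$ with $M\le_{\mathfrak k}N\Rightarrow M\subseteq N$ (submodel), such that the following hold. Here $|M|$ denotes the universe of $M$ and $\|M\|$ its cardinality. - (II) (a) $K$ is closed under isomorphism. (b) If $(N_1,M_1)\cong(N_2,M_2)$ then $M_1\le_{\mathfrak k}N_1\Leftrightarrow M_2\le_{\mathfrak k}N_2$. (c) Every $M\in K$ has cardinality in $[\lambda,\mu)$. (d) $\le_{\mathfrak k}$ is a partial order on $K$. - (III$_1$) If $\delta$ is a limit ordinal, $\langle M_i:i<\delta\rangle$ is $\le_{\mathfrak k}$-increasing and $|\bigcup_{i<\delta}|M_i||<\mu$,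 then there is a unique $M\in K$ with universe $\bigcup_{i<\delta}|M_i|$ such that $M_i\le_{\mathfrak k}M$ for all $i<\delta$. (This $M$ is called the union of the sequence.) - (III$_2$) If in addition $M_i\le_{\mathfrak k}N$ for all $i<\delta$, then $M\le_{\mathfrak k}N$. - (IV) If $M_1\subseteq M_2$ and $M_\ell\le_{\mathfrak k}N$ for $\ell=1,2$, then $M_1\le_{\mathfrak k}M_2$. - (V) If $A\subseteq N\in K$ then there is $M$ with $A\subseteq M\le_{\mathfrak k}N$ and $\|M\|\le\lambda+|A|$. A sequence $\langle M_\alpha:\alpha\le\delta\rangle$ is $\le_{\mathfrak k}$-increasing continuous if it is $\le_{\mathfrak k}$-increasing and, for each limit ordinal $\alpha\le\delta$, $M_\alpha$ is the union (in the sense of (III$_1$)) of $\langle M_\beta:\beta<\alpha\rangle$. A $\le_{\mathfrak k}$-embedding of $M$ into $N$ is an isomorphism from $M$ onto some $M'\le_{\mathfrak k}N$. The amalgamation property: if $M_0\le_{\mathfrak k}M_\ell$ for $\ell=1,2$, then there are $M_3\in K$ and $\le_{\mathfrak k}$-embeddings $f_\ell:M_\ell\to M_3$ with $f_1\restriction M_0=f_2\restriction M_0$. **Smooth equivalence relation.** For $M\in K$ let $\mathrm{seq}(M)=\{\bar a\in{}^\lambda M: M\restriction\mathrm{Rang}(\bar a)\le_{\mathfrak k}M\}$ (repetitions allowed). A smooth $\mathfrak{k}$-equivalence relation is a function $\mathbb{E}$ with domain $K$, $M\mapsto\mathbb{E}_M$, such that: - (b) $\mathbb{E}_M$ is an equivalence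 relation on a subset $\mathrm{Dom}(\mathbb{E}_M)$ of $\mathrm{seq}(M)$; - (c) if $M_1\le_{\mathfrak k}M_2$ then $\mathbb{E}_{M_2}\restriction\mathrm{seq}(M_1)=\mathbb{E}_{M_1}$ (in particular $\mathrm{Dom}(\mathbb{E}_{M_2})\cap \mathrm{seq}(M_1)=\mathrm{Dom}(\mathbb{E}_{M_1})$); - (d) every isomorphism from $M_1\in K$ onto $M_2$ maps $\mathbb{E}_{M_1}$ onto $\mathbb{E}_{M_2}$; - (e) if $\delta$ is a limit ordinal and $\langle M_\alpha:\alpha\le\delta\rangle$ is $\le_{\mathfrak k}$-increasing continuous, then $\{\bar a/\mathbb{E}_{M_\delta}:\bar a\in\mathrm{Dom}(\mathbb{E}_{M_\delta})\}=\{\bar a/\mathbb{E}_{M_\delta}:\bar a\in\bigcup_{\alpha<\delta}\mathrm{Dom}(\mathbb{E}_{M_\alpha})\}$. $\mathbb{E}$ is small if each $\mathbb{E}_M$ has at most $\|M\|$ equivalence classes. **The class $\mathfrak{k}\langle\mathbb{E}\rangle$.** Let $F_*,c_*,P_*\notin\tau_{\mathfrak k}$. Put $\tau^*=\tau_{\mathfrak k}\cup\{F_*,c_*,P_*\}$ with $P_*$ a unary predicate, $c_*$ an individual constant and $F_*$ a $\lambda$-place function symbol. Let $K_{\mathfrak{k}\langle\mathbb{E}\rangle}$ be the class of $\tau^*$-models $M^*$ such that for some $M\in K_{\mathfrak k}$ (called a witness for $M^*$): - $|M|=P_*^{M^*}$; $R^{M^*}=R^M$ for every predicate $R\in\tau_{\mathfrak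 k}$; and for every function symbol $F\in\tau_{\mathfrak k}$ of arity $\alpha$, $F^{M^*}$ extends $F^M$ and $F^{M^*}(\bar a)=c_*^{M^*}$ for $\bar a\in{}^\alpha(M^* )\setminus{}^\alpha M$; - $c_*^{M^*}\notin|M|$; - if $\bar a\in\mathrm{Dom}(\mathbb{E}_M)$ then $F_*^{M^*}(\bar a)\in|M^*|\setminus|M|\setminus\{c_*^{M^*}\}$; if $\bar a,\bar b\in\mathrm{Dom}(\mathbb{E}_M)$ then $F_*^{M^*}(\bar a)=F_*^{M^*}(\bar b)\Leftrightarrow\bar a\,\mathbb{E}_M\,\bar b$; if $\bar a\in{}^\lambda(M^* )\setminus\mathrm{Dom}(\mathbb{E}_M)$ then $F_*^{M^*}(\bar a)=c_*^{M^*}$; - every $b\in|M^*|\setminus|M|\setminus\{c_*^{M^*}\}$ equals $F_*^{M^*}(\bar a)$ for some $\bar a\in\mathrm{Dom}(\mathbb{E}_M)$. The order: $M^*\le_{\mathfrak{k}\langle\mathbb{E}\rangle}N^*$ iff $M^*\subseteq N^*$ and the witnesses $M,N$ of $M^*,N^*$ satisfy $M\le_{\mathfrak k}N$. *)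

(* Defs.v *)
From mathcomp Require Import all_boot.
From mathcomp Require Import boolp classical_sets functions cardinality.

Set Implicit Arguments.
Unset Strict Implicit.
Unset Printing Implicit Defensive.

Local Open Scope classical_set_scope.
Local Open Scope card_scope.

(* The types of [Small] play the role of sets: cardinals, ordinals, arities and
   vocabularies live there.  [V], one universe above, is the proper class from
   which the elements of models are taken: every small type embeds in it, even
   outside any given small part.  Only the points of [V] matter below; its tree
   structure is not used as a membership relation. *)
Definition Small := Type.

Inductive V : Type := sup (A : Small) (f : A -> V).

Definition junk : V := sup (of_void V).

Definition set_sized (A : set V) : Prop := exists X : Small, A #<= [set: X].

(* An arity is given by its index set; individual constants are the function
   symbols indexed by [void]. *)
Record vocabulary := Vocabulary {
  pred_sym : Small;
  pred_ar : pred_sym -> Small;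
  fun_sym : Small;
  fun_ar : fun_sym -> Small }.

Definition tuples (I : Type) (A : set V) : set (I -> V) :=
  [set a | forall i, A (a i)].
Arguments tuples : clear implicits.

(* Outside the tuples of the universe, relations are false and functions take
   the value [junk]; hence Leibniz equality of models is equality of universes
   and of interpretations, as in set theory. *)
Record model (tau : vocabulary) := Model {
  univ : set V;
  rel : forall R : pred_sym tau, set (pred_ar R -> V);
  fn : forall F : fun_sym tau, (fun_ar F -> V) -> V;
  univ_small : set_sized univ;
  rel_univ : forall R, @rel R `<=` tuples (pred_ar R) univ;
  fn_univ : forall F a, tuples (fun_ar F) univ a -> univ (@fn F a);
  fn_junk : forall F a, ~ tuples (fun_ar F) univ a -> @fn F a = junk }.
Arguments rel {tau} m R _.
Arguments fn {tau} m F a.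

Record submodel tau (M N : model tau) : Prop := Submodel {
  sub_univ : univ M `<=` univ N;
  sub_rel : forall R a, tuples (pred_ar R) (univ M) a -> (rel M R a <-> rel N R a);
  sub_fn : forall F a, tuples (fun_ar F) (univ M) a -> fn M F a = fn N F a }.

(* Only the restriction of [f] to the universe of [M] matters. *)
Record isomorphism tau (f : V -> V) (M N : model tau) : Prop := Isomorphism {
  iso_inj : {in univ M &, injective f};
  iso_onto : f @` univ M = univ N;
  iso_rel : forall R a, tuples (pred_ar R) (univ M) a ->
    (rel M R a <-> rel N R (f \o a));
  iso_fn : forall F a, tuples (fun_ar F) (univ M) a ->
    f (fn M F a) = fn N F (f \o a) }.

Definition card_lt T U (A : set T) (B : set U) : Prop := A #<= B /\ ~ (B #<= A).

(* [None] stands for infinity. *)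
Definition below T (A : set T) (mu : option Small) : Prop :=
  if mu is Some m then card_lt A [set: m] else True.

(* A limit ordinal is given by its elements and their order. *)
Record limit_ordinal := LimitOrdinal {
  ord : Small;
  olt : ord -> ord -> Prop;
  olt_wf : well_founded olt;
  olt_trans : forall i j l, olt i j -> olt j l -> olt i l;
  olt_total : forall i j, olt i j \/ i = j \/ olt j i;
  ord_nonempty : inhabited ord;
  ord_nomax : forall i, exists j, olt i j }.
Arguments olt {_} _ _.

Definition limit_element (d : limit_ordinal) (i : ord d) : Prop :=
  (exists j, olt j i) /\ forall j, olt j i -> exists2 l, olt j l & olt l i.

Record ordered_class := OrderedClass {
  voc : vocabulary;
  inK : set (model voc);
  leK : model voc -> model voc -> Prop }.

Arguments inK _ _ : clear implicits.
Arguments leK {_} _ _.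

Section OrderedClass.
Variable k : ordered_class.
Implicit Types M N : model (voc k).

Definition increasing (d : limit_ordinal) (M : ord d -> model (voc k)) : Prop :=
  forall i j, olt i j -> leK (M i) (M j).

Definition is_union (I : Type) (S : set I) (M : I -> model (voc k)) N : Prop :=
  [/\ inK k N, univ N = \bigcup_(i in S) univ (M i) &
      forall i, S i -> leK (M i) N].

(* The sequence of length d + 1 consists of the [M i], for i < d, followed by
   [Md]. *)
Record increasing_continuous (d : limit_ordinal) (M : ord d -> model (voc k)) Md
    : Prop := IncreasingContinuous {
  ic_incr : increasing M;
  ic_top : forall i, leK (M i) Md;
  ic_lim : forall i, limit_element i -> is_union [set j | olt j i] M (M i);
  ic_lim_top : is_union [set: ord d] M Md }.

Record ess_aec (lam : Small) (mu : option Small) : Prop := EssAec {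
  aec_pred_ar : forall R : pred_sym (voc k), [set: pred_ar R] #<= [set: lam];
  aec_fun_ar : forall F : fun_sym (voc k), [set: fun_ar F] #<= [set: lam];
  aec_le_inK : forall M N, leK M N -> inK k M /\ inK k N;
  aec_le_sub : forall M N, leK M N -> submodel M N;
  aec_iso : forall f M N, inK k M -> isomorphism f M N -> inK k N;
  aec_le_iso : forall f M1 N1 M2 N2, submodel M1 N1 -> submodel M2 N2 ->
    isomorphism f N1 N2 -> isomorphism f M1 M2 -> (leK M1 N1 <-> leK M2 N2);
  aec_card : forall M, inK k M -> [set: lam] #<= univ M /\ below (univ M) mu;
  aec_refl : forall M, inK k M -> leK M M;
  aec_antisym : forall M N, leK M N -> leK N M -> M = N;
  aec_trans : forall M N P, leK M N -> leK N P -> leK M P;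
  aec_union : forall (d : limit_ordinal) (M : ord d -> model (voc k)),
    increasing M -> below (\bigcup_i univ (M i)) mu ->
    exists! N, is_union [set: ord d] M N;
  aec_union_le : forall (d : limit_ordinal) (M : ord d -> model (voc k)) N P,
    increasing M -> below (\bigcup_i univ (M i)) mu ->
    is_union [set: ord d] M N -> (forall i, leK (M i) P) -> leK N P;
  aec_coherence : forall M1 M2 N, submodel M1 M2 -> leK M1 N -> leK M2 N ->
    leK M1 M2;
  aec_LS : forall (A : set V) N, inK k N -> A `<=` univ N ->
    exists M, [/\ A `<=` univ M, leK M N & univ M #<= [set: (lam + A)%type]] }.

Definition embedding (f : V -> V) M N : Prop :=
  exists2 M', isomorphism f M M' & leK M' N.

Definition amalgamation : Prop := forall M0 M1 M2, leK M0 M1 -> leK M0 M2 ->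
  exists M3 f1 f2, [/\ inK k M3, embedding f1 M1 M3, embedding f2 M2 M3 &
    forall x, univ M0 x -> f1 x = f2 x].

Variable lam : Small.

Definition seqs M : set (lam -> V) :=
  [set a | exists M0, [/\ submodel M0 M, univ M0 = range a & leK M0 M]].

(* A function M |-> E_M; its values outside the class are irrelevant. *)
Definition tuple_relation := model (voc k) -> (lam -> V) -> (lam -> V) -> Prop.

Variable E : tuple_relation.

Definition Dom M : set (lam -> V) := [set a | exists b, E M a b].

Definition eqclass M (a : lam -> V) : set (lam -> V) := [set b | E M a b].

Record smooth : Prop := Smooth {
  smooth_dom : forall M a b, inK k M -> E M a b -> seqs M a /\ seqs M b;
  smooth_refl : forall M a, inK k M -> Dom M a -> E M a a;
  smooth_sym : forall M a b, inK k M -> E M a b -> E M b a;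
  smooth_trans : forall M a b c, inK k M -> E M a b -> E M b c -> E M a c;
  smooth_le : forall M1 M2 a b, leK M1 M2 -> seqs M1 a -> seqs M1 b ->
    (E M2 a b <-> E M1 a b);
  smooth_iso : forall f M1 M2 a b, inK k M1 -> isomorphism f M1 M2 ->
    tuples lam (univ M1) a -> tuples lam (univ M1) b ->
    (E M1 a b <-> E M2 (f \o a) (f \o b));
  smooth_cont : forall (d : limit_ordinal) (M : ord d -> model (voc k)) Md,
    increasing_continuous M Md ->
    [set eqclass Md a | a in Dom Md] =
    [set eqclass Md a | a in \bigcup_i Dom (M i)] }.

Definition small : Prop := forall M, inK k M ->
  [set eqclass M a | a in Dom M] #<= univ M.

Inductive pred_star : Small := PStar | OldPred (R : pred_sym (voc k)).
Inductive fun_star : Small := FStar | CStar | OldFun (F : fun_sym (voc k)).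

Definition voc_star : vocabulary := {|
  pred_sym := pred_star;
  pred_ar R := match R with PStar => unit | OldPred R => pred_ar R end;
  fun_sym := fun_star;
  fun_ar F := match F with
    | FStar => lam | CStar => void | OldFun F => fun_ar F end |}.

Implicit Type Ms : model voc_star.

Definition Pstar Ms : set V := [set x | rel Ms PStar (fun=> x)].
Definition cstar Ms : V := fn Ms CStar (of_void V).
Definition Fstar Ms (a : lam -> V) : V := fn Ms FStar a.

Record witness M Ms : Prop := Witness {
  wit_univ : univ M = Pstar Ms;
  wit_rel : forall R, rel Ms (OldPred R) = rel M R;
  wit_fn : forall F a, tuples (fun_ar F) (univ M) a ->
    fn Ms (OldFun F) a = fn M F a;
  wit_fn_out : forall F a, (tuples (fun_ar F) (univ Ms) `\`
    tuples (fun_ar F) (univ M)) a -> fn Ms (OldFun F) a = cstar Ms;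
  wit_cstar : ~ univ M (cstar Ms);
  wit_Fstar : forall a, Dom M a ->
    (univ Ms `\` univ M `\ cstar Ms) (Fstar Ms a);
  wit_Fstar_eq : forall a b, Dom M a -> Dom M b ->
    (Fstar Ms a = Fstar Ms b <-> E M a b);
  wit_Fstar_out : forall a, (tuples lam (univ Ms) `\` Dom M) a ->
    Fstar Ms a = cstar Ms;
  wit_onto : forall b, (univ Ms `\` univ M `\ cstar Ms) b ->
    exists2 a, Dom M a & b = Fstar Ms a }.

Definition class_star : ordered_class := {|
  voc := voc_star;
  inK := [set Ms | exists2 M, inK k M & witness M Ms];
  leK Ms Ns := submodel Ms Ns /\ exists M N,
    [/\ inK k M /\ inK k N, witness M Ms, witness N Ns & leK M N] |}.

End OrderedClass.

(* Main.v *)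
Require Import Defs.
From mathcomp Require Import all_boot.
From mathcomp Require Import boolp classical_sets functions cardinality.

Local Open Scope classical_set_scope.

Set Implicit Arguments.
Unset Strict Implicit.
Unset Printing Implicit Defensive.

(** Over [M] in [k], a model of [class_star E] amounts to a new point [c] together
   with new points, one for each class of [E M]; [star_exists] builds it from
   them.  The order adds nothing but agreement of these choices: by
   [star_submodel], if [M <= N] in [k] and the expansions of [M] and [N] have the
   same [c] and the same points for the classes of [E M], then the first is a
   submodel of the second.  The reason is coherence: a tuple of [M] in the domain
   of [E N] enumerates some [M0 <= N], hence [M0 <= M], and it is already in the
   domain of [E M].  So each axiom for [class_star E] reduces to the same axiom
   for [k], applied to witnesses, plus a choice of [c] and of the points for the
   classes.

   - Unions.  Let [N] be the union of the witnesses.  By smoothness each class of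
     [E N] meets the domain of some [E (M i)] ([union_class]), so its point is
     dictated by the expansion of [M i].  This both defines the union
     ([star_union_exists]) and shows that it is unique and below every upper
     bound ([star_union_submodel]).  Smoothness speaks of continuous sequences
     only; [continuous_refinement] supplies one.
   - Cardinals.  An expansion of [M] has the cardinality of [M], because [E] is
     small and [M] is infinite.  For the Loewenheim-Skolem axiom ([star_LS]), a
     point outside [P_*] is replaced by the [lam] entries of a tuple of its class;
     [lam * |A| <= lam + |A|] is Hessenberg's theorem ([card_le_square]).
   - Amalgamation.  Any expansion of an amalgam [M3] works: a [k]-embedding of [M]
     into [M3] extends to the expansions in exactly one way ([iso_extend]), by
     sending classes to classes, so two embeddings that agree on [M0] extend to
     embeddings that agree on the expansion of [M0].

   Points for the classes of [E M3] exist because no small set exhausts [V]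
   ([fresh_points]). *)

Local Open Scope card_scope.

(** * Infinite cardinals *)

Lemma card_le_fun T U (A : set T) (B : set U) (f : T -> U) :
  (forall x, A x -> B (f x)) ->
  (forall x y, A x -> A y -> f x = f y -> x = y) -> A #<= B.
Proof.
move=> fAB finj; apply: (@card_le_trans _ _ _ (f @` A)).
  have : f @` A #= A by apply: inj_card_eq => x y /set_mem Ax /set_mem Ay; exact: finj.
  by rewrite card_eq_le => /andP[].
by apply: subset_card_le => _ [x Ax <-]; exact: fAB.
Qed.

Lemma card_le_rel T U (A : set T) (B : set U) (R : T -> U -> Prop) :
  (forall x, A x -> exists2 y, B y & R x y) ->
  (forall x x' y, R x y -> R x' y -> x = x') -> A #<= B.
Proof.
move=> RAB Rinj.
have /choice[f fP] : forall x : A, exists y, B y /\ R (set_val x) y.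
  by move=> x; have [y] := RAB _ (set_valP x); exists y.
apply: (@card_le_trans _ _ _ [set: A]).
  by have := card_setT_sym A; rewrite card_eq_le => /andP[].
apply: (@card_le_fun _ _ _ _ f) => [x _|x y _ _ fxy]; first by case: (fP x).
by apply: val_inj; apply: (Rinj _ _ (f x)); [case: (fP x) | rewrite fxy; case: (fP y)].
Qed.

Lemma card_leE T U (A : set T) (B : set U) (u0 : U) : A #<= B ->
  exists2 f : T -> U, forall x, A x -> B (f x) &
    forall x y, A x -> A y -> f x = f y -> x = y.
Proof.
move=> /card_leP[g].
have /choice[f fP] : forall x, exists y, forall Ax : A x,
    y = set_val (g (SigSub (mem_set Ax))).
  move=> x; have [Ax|nAx] := pselect (A x); last by exists u0 => Ax; case: nAx.
  by exists (set_val (g (SigSub (mem_set Ax)))) => Ax'; rewrite (Prop_irrelevance Ax Ax').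
exists f => [x Ax|x y Ax Ay].
  by rewrite (fP _ Ax); apply: set_valP.
rewrite (fP _ Ax) (fP _ Ay) => /val_inj gxy.
have := @inj _ _ _ g _ _ _ _ gxy; rewrite !in_setT => /(_ isT isT).
by move=> /(congr1 val).
Qed.

Lemma card_le_setX2 T T' U (A : set T) (B : set T') (C : set U) (c0 : U) :
  A #<= C -> B #<= C -> A `*` B #<= C `*` C.
Proof.
move=> /(card_leE c0)[f fA finj] /(card_leE c0)[g gB ginj].
apply: (@card_le_fun _ _ _ _ (fun p => (f p.1, g p.2))) => [[x y] [Ax By]|].
  by split; [exact: fA | exact: gB].
by move=> [x y] [x' y'] [/= Ax By] [/= Ax' By'] [/finj -> // /ginj -> //].
Qed.

Lemma bigcup_chain2 T (F : set (set T)) p q : total_on F subset ->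
  (\bigcup_(X in F) X) p -> (\bigcup_(X in F) X) q -> exists X, [/\ F X, X p & X q].
Proof.
move=> Ftot [X FX Xp] [Y FY Yq].
by have [XY|YX] := Ftot _ _ FX FY; [exists Y|exists X]; split; auto.
Qed.

(** A maximal partial injection from [A] to [B] exhausts one side. *)
Lemma card_le_total T U (A : set T) (B : set U) : A #<= B \/ B #<= A.
Proof.
pose P (G : set (T * U)) := [/\ G `<=` A `*` B,
  forall x y y', G (x, y) -> G (x, y') -> y = y' &
  forall x x' y, G (x, y) -> G (x', y) -> x = x'].
have [F FP Ftot|G [[GAB Gfun Ginj] Gmax]] := @Zorn_bigcup _ P.
  have pick p q := @bigcup_chain2 _ F p q Ftot.
  split.
  - by move=> p [X /FP[XAB _ _]]; exact: XAB.
  - move=> x y y' /pick/[apply] -[X [/FP[_ Xfun _]]]; exact: Xfun.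
  - move=> x x' y /pick/[apply] -[X [/FP[_ _ Xinj]]]; exact: Xinj.
have [Adom|/existsNP[a /not_implyP[Aa na]]] :=
    pselect (forall x, A x -> exists y, G (x, y)).
  left; apply: (@card_le_rel _ _ _ _ (fun x y => G (x, y))) => //.
  by move=> x /Adom[y Gxy]; exists y => //; case: (GAB _ Gxy).
have [Bdom|/existsNP[b /not_implyP[Bb nb]]] :=
    pselect (forall y, B y -> exists x, G (x, y)).
  right; apply: (@card_le_rel _ _ _ _ (fun y x => G (x, y))).
    by move=> y /Bdom[x Gxy]; exists x => //; case: (GAB _ Gxy).
  by move=> y y' x; exact: Gfun.
exfalso; apply: (Gmax (G `|` [set (a, b)])).
  split; [exact: subsetUl|move=> /(_ (a, b) (or_intror erefl)) Gab].
  by apply: na; exists b.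
split.
- by move=> p [/GAB //|->].
- move=> x y y' [Gxy|[-> ->]] [Gxy'|[]]; first exact: Gfun Gxy Gxy'.
  + by move=> xa; case: na; exists y; rewrite -xa.
  + by case: na; exists y'.
  + by [].
- move=> x x' y [Gxy|[-> ->]] [Gxy'|[]]; first exact: Ginj Gxy Gxy'.
  + by move=> _ yb; case: nb; exists x; rewrite -yb.
  + by case: nb; exists x'.
  + by [].
Qed.

(** Two points of [C] tag two copies of [C] inside its square. *)
Lemma card_le_setU_square T U (A B : set T) (C : set U) :
  C `*` C #<= C -> infinite_set C -> A #<= C -> B #<= C -> A `|` B #<= C.
Proof.
move=> CC Cinf leA leB; apply: card_le_trans CC; move: leA leB.
have [c0 Cc0] := infinite_setN0 Cinf.
have [c1 [Cc1 c10]] : exists c1, C c1 /\ c1 <> c0.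
  apply: contrapT => no; apply: Cinf; apply: (@sub_finite_set _ _ [set c0]) => //.
  by move=> c Cc; apply: contrapT => cc0; apply: no; exists c.
move=> /(card_leE c0)[f fA finj] /(card_leE c0)[g gB ginj].
apply: (@card_le_fun _ _ _ _ (fun x => if `[< A x >] then (c0, f x) else (c1, g x))).
  by move=> x; case: asboolP => [Ax _|nAx [//|Bx]]; split=> //=; auto.
move=> x y; case: asboolP => [Ax _|nAx [//|Bx]]; case: asboolP => [Ay _|nAy [//|By]].
- by move=> [/finj]; apply.
- by move=> [/esym].
- by move=> [].
- by move=> [/ginj]; apply.
Qed.

(** Hessenberg's theorem.  Among the infinite [D `<=` A] that carry an injection
   of [D `*` D] into [D], take a maximal one; the graph of the injection is a
   set of triples, of which [D] is the diagonal domain.  If [A `\` D] does not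
   embed in [D], then it contains a copy [B] of [D], and [B] can receive all the
   new pairs of [D `|` B]; otherwise [A] has the size of [D]. *)
Lemma card_le_square T (A : set T) : infinite_set A -> A `*` A #<= A.
Proof.
move=> Ainf.
pose dom (G : set (T * T * T)) := [set x | exists y, G (x, x, y)].
pose P (G : set (T * T * T)) := [/\ dom G `<=` A, G = set0 \/ infinite_set (dom G),
  forall x x', dom G x -> dom G x' -> exists y, G (x, x', y),
  forall x x' y, G (x, x', y) -> [/\ dom G x, dom G x' & dom G y] &
  forall p p' y, G (p, y) -> G (p', y) -> p = p'].
have domS (G H : set (T * T * T)) : G `<=` H -> dom G `<=` dom H.
  by move=> GH x [y /GH]; exists y.
have [F FP Ftot|G [[GA Ginf Gdom Gran Ginj] Gmax]] := @Zorn_bigcup _ P.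
  have up X : F X -> X `<=` \bigcup_(X in F) X by move=> FX p Xp; exists X.
  have pick p q := @bigcup_chain2 _ F p q Ftot.
  split.
  - by move=> x [y [X FX Xx]]; have [XA _ _ _ _] := FP _ FX; apply: XA; exists y.
  - have [allE|/existsNP[X /not_implyP[FX X0]]] := pselect (forall X, F X -> X = set0).
      by left; apply/seteqP; split=> [p [X /allE -> //]|//].
    right; apply: (sub_infinite_set (domS _ _ (up _ FX))).
    by have [_ [//|]] := FP _ FX.
  - move=> x x' [y xy] [y' xy']; have [X [FX Xx Xx']] := pick _ _ xy xy'.
    have [_ _ Xdom _ _] := FP _ FX.
    by have [||z Xz] := Xdom x x'; [exists y|exists y'|exists z; exists X].
  - move=> x x' y [X FX Xx]; have [_ _ _ /(_ _ _ _ Xx)[dx dx' dy] _] := FP _ FX.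
    by split; apply: domS (up _ FX) _ _.
  - move=> p p' y /pick/[apply] -[X [/FP[_ _ _ _ Xinj]]]; exact: Xinj.
set D := dom G in GA Gran Gdom.
(* A copy of the square of [D `|` B] inside [B] would extend the graph of the
   injection from [D] to [D `|` B]. *)
have noext B : B `<=` A `\` D -> infinite_set B ->
    (D `|` B) `*` (D `|` B) #<= B -> False.
  move=> BA Binf le; have [b0 Bb0] := infinite_setN0 Binf.
  have [g gB ginj] := card_leE b0 le.
  pose H := G `|` [set q | [/\ ((D `|` B) `*` (D `|` B)) q.1,
    ~ (D `*` D) q.1 & q.2 = g q.1]].
  have nD x : B x -> ~ D x by move=> /BA[].
  have domH : dom H = D `|` B.
    apply/seteqP; split=> [x [y [Gx|[[]//]]]|x [[y Gx]|Bx]].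
    - by left; exists y.
    - by exists y; left.
    - exists (g (x, x)); right; split=> //; first by split; right.
      by move=> [/(nD _ Bx)].
  apply: (Gmax H).
    split; [exact: subsetUl|move=> HG; apply: (nD _ Bb0)].
    by apply: (domS _ _ HG); rewrite domH; right.
  split.
  - by rewrite domH => x [/GA //|/BA[]].
  - by right; rewrite domH; apply: sub_infinite_set Binf; exact: subsetUr.
  - rewrite domH => x x' Dx Dx'.
    have [[/= x1 x2]|nDD] := pselect ((D `*` D) (x, x')).
      by have [y Gy] := Gdom _ _ x1 x2; exists y; left.
    by exists (g (x, x')); right.
  - rewrite domH => x x' y [/Gran[dx dx' dy]|[/= [] /= dx dx' _ ->]];
      split=> //; try by left.
    by right; apply: gB.
  - move=> p p' y [Gp|[/= DBp nDp ->]] [Gp'|[/= DBp' nDp' e]].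
    + exact: Ginj Gp Gp'.
    + case: p Gp => x x' /Gran[_ _]; rewrite e => Dy.
      by case: (nD _ _ Dy); apply: gB.
    + case: p' Gp' => x x' /Gran[_ _] Dy.
      by case: (nD _ _ Dy); apply: gB.
    + exact: ginj.
have Dinf : infinite_set D.
  case: Ginf => // G0; exfalso.
  have D0 : D = set0 by apply/seteqP; split=> // x [y]; rewrite G0.
  have [a0 _] := infinite_setN0 Ainf.
  move/infiniteP: (Ainf) => /(card_leE a0)[f fA finj]; apply: (noext [set f n | n in [set: nat]]).
  - by move=> _ [n _ <-]; split; [exact: fA|rewrite D0].
  - by apply/infiniteP; apply: (@card_le_fun _ _ _ _ f) => [n _|//]; exists n.
  - have ranf : range f #<= [set: nat] by exact: card_image_le.
    rewrite D0 set0U; apply: card_le_trans (card_le_setX2 0 ranf ranf) _.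
    apply: (@card_le_trans _ _ _ [set: nat]); first exact: countableP.
    by apply: (@card_le_fun _ _ _ _ f) => [n _|//]; exists n.
have [d0 Dd0] := infinite_setN0 Dinf.
have DD : D `*` D #<= D.
  apply: (@card_le_rel _ _ _ _ (fun p y => G (p, y))); last exact: Ginj.
  move=> [x x'] [/= Dx Dx']; have [y Gy] := Gdom _ _ Dx Dx'.
  by exists y => //; case: (Gran _ _ _ Gy).
have Dtwo := card_le_setU_square DD Dinf.
have [AD|DA] := card_le_total (A `\` D) D.
  have AleD : A #<= D.
    apply: card_le_trans (Dtwo _ D (A `\` D) (card_lexx D) AD).
    by apply: subset_card_le => x Ax; have [] := pselect (D x); [left|right].
  apply: card_le_trans (card_le_setX2 d0 AleD AleD) _.
  by apply: card_le_trans DD _; exact: subset_card_le.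
have [f fA finj] := card_leE d0 DA.
exfalso; have DfD : D #<= f @` D.
  by apply: (@card_le_fun _ _ _ _ f) => // x Dx; exists x.
apply: (noext (f @` D)).
- by move=> _ [x Dx <-]; exact: fA.
- by move/infiniteP: Dinf => /card_le_trans le; apply/infiniteP; exact: le.
- have le : D `|` f @` D #<= D by apply: Dtwo => //; exact: card_image_le.
  by apply: card_le_trans (card_le_setX2 d0 le le) _; exact: card_le_trans DD DfD.
Qed.

Lemma card_le_setU T U (A B : set T) (C : set U) :
  infinite_set C -> A #<= C -> B #<= C -> A `|` B #<= C.
Proof. by move=> Cinf; apply: card_le_setU_square (card_le_square Cinf) Cinf. Qed.

Lemma card_le_setX T T' U (A : set T) (B : set T') (C : set U) :
  infinite_set C -> A #<= C -> B #<= C -> A `*` B #<= C.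
Proof.
move=> Cinf leA leB; have [c0 _] := infinite_setN0 Cinf.
exact: card_le_trans (card_le_setX2 c0 leA leB) (card_le_square Cinf).
Qed.

(** * New points outside a small set *)

Lemma sup_inj (A : Small) (f g : A -> V) : sup f = sup g -> f = g.
Proof.
pose unsup v : A -> V := let: sup B h := v in
  if pselect (B = A) is left e then ecast T (T -> V) e h else fun=> junk.
have unsupK h : unsup (sup h) = h.
  by rewrite /unsup; case: pselect => // e; rewrite (Prop_irrelevance e erefl).
by move=> /(congr1 unsup); rewrite !unsupK.
Qed.

Lemma sup_neq (A : Small) (f : A -> V) x : sup f <> f x.
Proof.
pose child u v := let: sup B g := v in exists y, g y = u.
have child_irr v : ~ child v v.
  by elim: v => B g IH [y gy]; apply: (IH y); rewrite gy; exists y.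
by move=> e; apply: (child_irr (sup f)); exists x.
Qed.

Lemma set_sized_cover (S : set V) : set_sized S ->
  exists (X : Small) (h : X -> V), forall s, S s -> exists x, h x = s.
Proof.
move=> [X SX]; exists X.
have [->|/set0P[s0 Ss0]] := eqVneq S set0; first by exists (fun=> junk).
have [x0] : inhabited X.
  by have /card_leP[i] := SX; split; exact: set_val (i (SigSub (mem_set Ss0))).
have [i _ iinj] := card_leE x0 SX.
have /choice[h hP] : forall x, exists s, forall s', S s' -> i s' = x -> s = s'.
  move=> x; have [[s [Ss <-]]|no] := pselect (exists s, S s /\ i s = x).
    by exists s => s' Ss' /iinj <-.
  by exists junk => s Ss ix; case: no; exists s.
by exists h => s Ss; exists (i s); exact: hP.
Qed.

(** The branching of [sup] records a point of [X] through the position of the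
   child that differs from the others, and having all of [S] among its children
   keeps the new tree out of [S]. *)
Lemma fresh_points (S : set V) (X : Small) : set_sized S ->
  exists2 g : X -> V, injective g & forall x, ~ S (g x).
Proof.
move=> /set_sized_cover[Y [h hS]].
pose other : V := sup (fun _ : unit => junk).
have otherP : other <> junk by exact: (@sup_neq _ (fun _ : unit => junk) tt).
pose g x := sup (fun z : Y + X => match z with
  | inl y => h y | inr x' => if pselect (x' = x) then other else junk end).
exists g => [x x' /sup_inj/(congr1 (fun f => f (inr x)))/=|x /hS[y hy]].
  by do 2!case: pselect => //.
exact: (@sup_neq _ _ (inl y) (esym hy)).
Qed.

Lemma set_sized_le T (S : set V) (A : set T) (X : Small) :
  S #<= A -> A #<= [set: X] -> set_sized S.
Proof. by exists X; apply: card_le_trans; eassumption. Qed.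

Lemma set_sizedU (S S' : set V) : set_sized S -> set_sized S' -> set_sized (S `|` S').
Proof.
move=> /set_sized_cover[X [h hS]] /set_sized_cover[X' [h' hS']].
exists (X + X')%type; apply: (@card_le_rel _ _ _ _ (fun s z =>
  s = match z with inl x => h x | inr x => h' x end)); last by move=> s s' z -> ->.
by move=> s [/hS[x <-]|/hS'[x <-]]; [exists (inl x)|exists (inr x)].
Qed.

Lemma set_sized1 (v : V) : set_sized [set v].
Proof.
by exists unit; apply: (@card_le_fun _ _ _ _ (fun=> tt)) => // x y -> ->.
Qed.

(** * Submodels and isomorphisms *)

Section Models.
Variable tau : vocabulary.
Implicit Types M N : model tau.

Lemma model_eq M N : univ M = univ N -> (forall R a, Defs.rel M R a <-> Defs.rel N R a) ->
  (forall F a, fn M F a = fn N F a) -> M = N.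
Proof.
case: M N => [U r f Us rU fU fj] [U' r' f' Us' rU' fU' fj'] /= eU er ef.
have er' : r = r' by apply: functional_extensionality_dep => R; apply/seteqP; split=> a /er.
have ef' : f = f' by apply: functional_extensionality_dep => F; apply: funext.
subst; congr Model; exact: Prop_irrelevance.
Qed.

Lemma submodel_refl M : submodel M M.
Proof. by split. Qed.

Lemma submodel_trans M N P : submodel M N -> submodel N P -> submodel M P.
Proof.
move=> [uMN rMN fMN] [uNP rNP fNP]; split=> [x /uMN/uNP //|R a aM|F a aM].
- by rewrite rMN // rNP // => i; apply: uMN.
- by rewrite fMN // fNP // => i; apply: uMN.
Qed.

Lemma submodel_antisym M N : submodel M N -> submodel N M -> M = N.
Proof.
move=> [uMN rMN fMN] [uNM rNM fNM].
have eU : univ M = univ N by apply/seteqP.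
apply: model_eq => // [R a|F a].
  split=> [Ma|Na].
    by apply/rMN => //; exact: rel_univ Ma.
  by apply/rNM => //; exact: rel_univ Na.
have [aM|naM] := pselect (tuples (fun_ar F) (univ M) a); first exact: fMN.
by rewrite !fn_junk -?eU.
Qed.

Lemma submodel_coherence M1 M2 N :
  univ M1 `<=` univ M2 -> submodel M1 N -> submodel M2 N -> submodel M1 M2.
Proof.
move=> u12 [_ r1 f1] [_ r2 f2]; split=> // [R a aM|F a aM].
- by rewrite r1 // r2 // => i; apply: u12.
- by rewrite f1 // f2 // => i; apply: u12.
Qed.

Lemma isoI f M N : isomorphism f M N ->
  forall x y, univ M x -> univ M y -> f x = f y -> x = y.
Proof. by move=> [finj _ _ _] x y Mx My; apply: finj; exact: mem_set. Qed.

Lemma iso_univ f M N x : isomorphism f M N -> univ M x -> univ N (f x).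
Proof. by move=> [_ <- _ _] Mx; exists x. Qed.

Lemma iso_tuples f M N I a : isomorphism f M N ->
  tuples I (univ M) a -> tuples I (univ N) (f \o a).
Proof. by move=> fMN aM i; apply: iso_univ fMN (aM i). Qed.

Lemma tuples_image (f : V -> V) (A : set V) (I : Type) (b : I -> V) :
  tuples I (f @` A) b -> exists2 a, tuples I A a & b = f \o a.
Proof.
move=> bA; have /choice[a aP] : forall i, exists x, A x /\ f x = b i.
  by move=> i; have [x] := bA i; exists x.
by exists a => [i|]; [case: (aP i) | apply: funext => i /=; case: (aP i)].
Qed.

Lemma iso_lift f M N (I : Type) (b : I -> V) : isomorphism f M N ->
  tuples I (univ N) b -> exists2 a, tuples I (univ M) a & b = f \o a.
Proof. by move=> [_ <- _ _]; exact: tuples_image. Qed.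

Lemma iso_submodel f M1 N1 M2 N2 : submodel M1 N1 ->
  isomorphism f N1 N2 -> isomorphism f M1 M2 -> submodel M2 N2.
Proof.
move=> [u1 r1 f1] fN fM; split=> [y|R b /(iso_lift fM)[a aM ->]|F b /(iso_lift fM)[a aM ->]].
- by case: (fM) => _ <- _ _ [x Mx <-]; apply: iso_univ fN (u1 _ Mx).
- by rewrite -(iso_rel fM) // -(iso_rel fN) ?r1 // => i; apply: u1.
- by rewrite -(iso_fn fM) // -(iso_fn fN) ?f1 // => i; apply: u1.
Qed.

Lemma iso_inverse f g M N : {in univ M, cancel f g} ->
  isomorphism f M N -> isomorphism g N M.
Proof.
move=> fK fMN; have gf x : univ M x -> g (f x) = x by move=> /mem_set/fK.
have gfa I a : tuples I (univ M) a -> g \o (f \o a) = a.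
  by move=> aM; apply: funext => i; apply: gf.
split.
- move=> y y' /set_mem + /set_mem; rewrite -(iso_onto fMN) => -[x Mx <-] [x' Mx' <-].
  by rewrite !gf // => ->.
- apply/seteqP; split=> [_ [y + <-]|x Mx].
    by rewrite -(iso_onto fMN) => -[x Mx <-]; rewrite gf.
  by exists (f x); [exact: iso_univ fMN Mx | exact: gf].
- by move=> R b /(iso_lift fMN)[a aM ->]; rewrite gfa // (iso_rel fMN).
- move=> F b /(iso_lift fMN)[a aM ->]; rewrite gfa // -(iso_fn fMN) // gf //.
  exact: fn_univ.
Qed.

Lemma iso_image f M : (forall x y, univ M x -> univ M y -> f x = f y -> x = y) ->
  exists N, isomorphism f M N.
Proof.
move=> finj; have compI I a a' : tuples I (univ M) a -> tuples I (univ M) a' ->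
    f \o a = f \o a' -> a = a'.
  by move=> aM aM' e; apply: funext => i; apply: finj => //; exact: (congr1 (@^~ i) e).
(* The functions of the image, with [junk] outside the tuples of its universe. *)
have /choice[F0 F0P] : forall Fb : {F : fun_sym tau & fun_ar F -> V}, exists y,
    (forall a, tuples _ (univ M) a -> tagged Fb = f \o a -> y = f (fn M (tag Fb) a)) /\
    (~ tuples _ (f @` univ M) (tagged Fb) -> y = junk).
  move=> [F b] /=; have [[a aM ->]|no] := pselect (exists2 a, tuples _ (univ M) a & b = f \o a).
    exists (f (fn M F a)); split=> [a' aM' /compI -> //|].
    by case=> i /=; exists (a i).
  by exists junk; split=> // a aM e; case: no; exists a.
have F0E F a : tuples _ (univ M) a -> F0 (existT _ F (f \o a)) = f (fn M F a).
  by move=> aM; have [+ _] := F0P (existT _ F (f \o a)); apply.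
unshelve eexists.
  apply: (@Model tau (f @` univ M)
    (fun R => [set f \o a | a in Defs.rel M R]) (fun F b => F0 (existT _ F b))).
  - have [X MX] := univ_small M; exact: set_sized_le (card_image_le f _) MX.
  - by move=> R _ [a /rel_univ aM <-] i; exists (a i) => //; apply: aM.
  - by move=> F _ /tuples_image[a aM ->]; rewrite F0E //; exists (fn M F a) => //; exact: fn_univ.
  - by move=> F b nb; have [_ ->] := F0P (existT _ F b).
split=> //=.
- by move=> x y /set_mem Mx /set_mem My; exact: finj.
- move=> R a aM; split=> [Ra|[a' Ra' /compI <- //]]; first by exists a.
  exact: rel_univ Ra'.
- by move=> F a aM; rewrite F0E.
Qed.

End Models.

(** * Expansions of a model and their witnesses *)

Section Star.
Variables (lam : Small) (mu : option Small) (k : ordered_class).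
Variable E : tuple_relation k lam.
Hypotheses (lam_infinite : infinite_set [set: lam]).
Hypotheses (k_aec : ess_aec k lam mu) (E_smooth : smooth E) (E_small : small E).
Implicit Types (M N : model (voc k)) (Ms Ns : model (voc_star k lam)).

Lemma inK_infinite M : inK k M -> infinite_set (univ M).
Proof.
move=> /(aec_card k_aec)[lamM _]; apply/infiniteP.
by apply: card_le_trans lamM; exact/infiniteP.
Qed.

Lemma Dom_tuples M a : inK k M -> Dom E M a -> tuples lam (univ M) a.
Proof.
move=> KM [b /(smooth_dom E_smooth KM)[[M0 [[sub _ _] e _]] _]] i.
by apply: sub; rewrite e; exists i.
Qed.

(** Coherence: the model enumerated by [a] is below [N], hence below [M]. *)
Lemma seqs_le M N a : leK M N -> tuples lam (univ M) a -> seqs N a -> seqs M a.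
Proof.
move=> MN aM [M0 [sub0 e0 le0]].
have sub0M : submodel M0 M.
  apply: submodel_coherence sub0 (aec_le_sub k_aec MN).
  by rewrite e0 => _ [i _ <-].
by exists M0; split=> //; exact: aec_coherence k_aec _ _ _ sub0M le0 MN.
Qed.

Lemma E_le M N a b : leK M N -> tuples lam (univ M) a -> tuples lam (univ M) b ->
  E N a b <-> E M a b.
Proof.
move=> MN aM bM; have [KM KN] := aec_le_inK k_aec MN; split=> Eab.
  have [/(seqs_le MN aM) sa /(seqs_le MN bM) sb] := smooth_dom E_smooth KN Eab.
  by apply/(smooth_le E_smooth MN).
by have [sa sb] := smooth_dom E_smooth KM Eab; apply/(smooth_le E_smooth MN).
Qed.

Lemma Dom_refl M a : inK k M -> Dom E M a <-> E M a a.
Proof. by move=> KM; split=> [/(smooth_refl E_smooth KM) //|]; exists a. Qed.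

Lemma Dom_le M N a : leK M N -> tuples lam (univ M) a -> Dom E N a <-> Dom E M a.
Proof.
move=> MN aM; have [KM KN] := aec_le_inK k_aec MN.
by rewrite !Dom_refl //; exact: E_le.
Qed.

Lemma Dom_mono M N a : leK M N -> Dom E M a -> Dom E N a.
Proof.
move=> MN Da; have [KM KN] := aec_le_inK k_aec MN.
by apply/(Dom_le MN) => //; exact: Dom_tuples Da.
Qed.

Lemma Dom_iso f M N a : inK k M -> isomorphism f M N -> tuples lam (univ M) a ->
  Dom E M a <-> Dom E N (f \o a).
Proof.
move=> KM fMN aM; rewrite !Dom_refl //; last exact: aec_iso k_aec _ _ _ KM fMN.
exact: smooth_iso.
Qed.

Lemma eqclass_eq M a b : inK k M -> Dom E M a -> Dom E M b ->
  eqclass E M a = eqclass E M b <-> E M a b.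
Proof.
move=> KM Da Db; split=> [e|Eab].
  have : eqclass E M b b by exact: smooth_refl.
  by rewrite -e.
apply/seteqP; split=> c Ec; last exact: (smooth_trans E_smooth KM Eab).
by apply: (smooth_trans E_smooth KM) Ec; exact: smooth_sym.
Qed.

Lemma card_class_image M (G : (lam -> V) -> V) : inK k M ->
  (forall a b, Dom E M a -> Dom E M b -> E M a b -> G a = G b) ->
  G @` Dom E M #<= univ M.
Proof.
move=> KM GE; apply: card_le_trans (E_small KM).
apply: (@card_le_rel _ _ _ _
  (fun x C => exists a, [/\ Dom E M a, x = G a & C = eqclass E M a])).
  by move=> _ [a Da <-]; exists (eqclass E M a); exists a.
by move=> x x' C [a [Da -> ->]] [b [Db -> /eqclass_eq eC]]; apply: GE => //; exact: eC.
Qed.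

Lemma cstar_univ Ms : univ Ms (cstar Ms).
Proof. by apply: (@fn_univ _ Ms (CStar k)) => -[]. Qed.

Lemma Pstar_univ Ms : Pstar Ms `<=` univ Ms.
Proof. by move=> x /rel_univ/(_ tt). Qed.

Lemma rel_PStar Ms a : Defs.rel Ms (PStar k) a <-> Pstar Ms (a tt).
Proof. by rewrite /Pstar /=; suff -> : a = fun=> a tt by []; apply: funext => -[]. Qed.

Lemma fn_CStar Ms a : fn Ms (CStar k) a = cstar Ms.
Proof. by congr (fn Ms); apply: funext => -[]. Qed.

Section Witness.
Variables (M : model (voc k)) (Ms : model (voc_star k lam)).
Hypotheses (KM : inK k M) (w : witness E M Ms).

Lemma wit_sub : univ M `<=` univ Ms.
Proof. by rewrite (wit_univ w); exact: Pstar_univ. Qed.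

Lemma Fstar_univ a : Dom E M a -> univ Ms (Fstar Ms a).
Proof. by move=> /(wit_Fstar w)[[]]. Qed.

Lemma Fstar_out a : Dom E M a -> ~ univ M (Fstar Ms a).
Proof. by move=> /(wit_Fstar w)[[]]. Qed.

Lemma Fstar_cstar a : Dom E M a -> Fstar Ms a <> cstar Ms.
Proof. by move=> /(wit_Fstar w)[]. Qed.

Lemma star_cases x : univ Ms x ->
  [\/ univ M x, x = cstar Ms | exists2 a, Dom E M a & x = Fstar Ms a].
Proof.
move=> Msx; have [Mx|nMx] := pselect (univ M x); first by apply: Or31.
have [xc|xc] := pselect (x = cstar Ms); first by apply: Or32.
by apply: Or33; apply: (wit_onto w).
Qed.

Lemma card_star : univ Ms #<= univ M.
Proof.
have Minf := inK_infinite KM.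
have le : univ Ms `<=` (univ M `|` [set cstar Ms]) `|` (Fstar Ms @` Dom E M).
  move=> x /star_cases[Mx|->|[a Da ->]]; first by left; left.
    by left; right.
  by right; exists a.
apply: card_le_trans (subset_card_le le) _.
apply: card_le_setU => //; first apply: card_le_setU => //.
  have [m Mm] := infinite_setN0 Minf.
  by apply: (@card_le_fun _ _ _ _ (fun=> m)) => // x y -> ->.
apply: card_class_image => // a b Da Db; exact: (wit_Fstar_eq w Da Db).2.
Qed.

End Witness.

Lemma wit_unique M N Ms : witness E M Ms -> witness E N Ms -> M = N.
Proof.
move=> wM wN; have eU : univ M = univ N by rewrite (wit_univ wM) (wit_univ wN).
apply: model_eq => // [R a|F a]; first by rewrite -(wit_rel wM) (wit_rel wN).
have [aM|naM] := pselect (tuples (fun_ar F) (univ M) a).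
  by rewrite -(wit_fn wM) // (wit_fn wN) // -eU.
by rewrite !fn_junk // -eU.
Qed.

(** An extension of witnesses lifts as soon as the new functions agree on the old
   domain.  By coherence no tuple of [M] enters the domain of the relation only
   in [N], and the points that [Ms] adds to [M] are outside [N] too. *)
Lemma star_submodel M N Ms Ns : witness E M Ms -> witness E N Ns -> leK M N ->
  cstar Ms = cstar Ns -> (forall a, Dom E M a -> Fstar Ms a = Fstar Ns a) ->
  submodel Ms Ns.
Proof.
move=> wM wN MN ec eF; have [KM KN] := aec_le_inK k_aec MN.
have [uMN rMN fMN] := aec_le_sub k_aec MN.
have u : univ Ms `<=` univ Ns.
  move=> x /(star_cases wM)[/uMN Nx|->|[a Da ->]].
  - exact: (wit_sub wN).
  - by rewrite ec; exact: cstar_univ.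
  - by rewrite eF //; apply: (Fstar_univ wN); exact: Dom_mono Da.
(* The points of [Ms] outside [M] stay outside [N]. *)
have sep x : univ Ms x -> univ N x -> univ M x.
  move=> /(star_cases wM)[//|-> Nc|[a Da ->]].
    by case: (wit_cstar wN); rewrite -ec.
  by rewrite eF // => /(Fstar_out wN); case; exact: Dom_mono Da.
split=> //.
- case=> [|R] a aMs.
    rewrite !rel_PStar -(wit_univ wM) -(wit_univ wN); split=> [/uMN //|].
    by apply: sep; apply: aMs.
  rewrite (wit_rel wM) (wit_rel wN); split=> Ra.
    by apply/rMN => //; exact: rel_univ Ra.
  by apply/rMN => //; move=> i; apply: sep; [exact: aMs | exact: (rel_univ Ra)].
- case=> [||F] a aMs.
  + have [Da|nDa] := pselect (Dom E M a); first exact: eF.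
    rewrite -!/(Fstar _ a) (wit_Fstar_out wM) // (wit_Fstar_out wN) //.
    split=> [i|Da]; first by apply: u; exact: aMs.
    apply: nDa; apply/(Dom_le MN) => // i.
    by apply: sep; [exact: aMs | exact: Dom_tuples Da i].
  + by rewrite !fn_CStar.
  + have [aM|naM] := pselect (tuples (fun_ar F) (univ M) a).
      by rewrite (wit_fn wM) // (wit_fn wN) ?fMN // => i; exact: uMN.
    rewrite (wit_fn_out wM) // (wit_fn_out wN) //; split=> [i|aN].
      by apply: u; exact: aMs.
    by apply: naM => i; apply: sep; [exact: aMs | exact: aN].
Qed.

(** The expansions of [M] are the choices of a new point [c] and of new points for
   the classes of [E M]. *)
Lemma star_exists M c (G : (lam -> V) -> V) : inK k M -> ~ univ M c ->
  (forall a, Dom E M a -> ~ univ M (G a)) -> (forall a, Dom E M a -> G a <> c) ->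
  (forall a b, Dom E M a -> Dom E M b -> G a = G b <-> E M a b) ->
  exists Ms, [/\ witness E M Ms, cstar Ms = c &
    forall a, Dom E M a -> Fstar Ms a = G a].
Proof.
move=> KM cM GM Gc GE.
pose U := univ M `|` [set c] `|` (G @` Dom E M).
have MU I a : tuples I (univ M) a -> tuples I U a by move=> aM i; left; left.
have cU : U c by left; right.
pose r (R : pred_sym (voc_star k lam)) : set (pred_ar R -> V) :=
  match R return set (@pred_ar (voc_star k lam) R -> V) with
  | PStar => fun a => univ M (a tt) | OldPred R => Defs.rel M R end.
pose f (F : fun_sym (voc_star k lam)) : (fun_ar F -> V) -> V :=
  match F return (@fun_ar (voc_star k lam) F -> V) -> V with
  | FStar => fun a => if pselect (Dom E M a) then G a else
      if pselect (tuples lam U a) then c else junk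
  | CStar => fun=> c
  | OldFun F => fun a => if pselect (tuples (fun_ar F) (univ M) a) then fn M F a else
      if pselect (tuples (fun_ar F) U a) then c else junk end.
have UG a : Dom E M a -> U (G a) by move=> Da; right; exists a.
have Usmall : set_sized U.
  apply: set_sizedU; first by apply: set_sizedU; [exact: univ_small | exact: set_sized1].
  have [X MX] := univ_small M; apply: set_sized_le MX.
  by apply: card_class_image => // a b Da Db; exact: (GE a b Da Db).2.
have rU R : r R `<=` tuples (pred_ar R) U.
  by case: R => [|R] a /=; [move=> Ma []; left; left | move=> /rel_univ/MU].
have fU F a : tuples (fun_ar F) U a -> U (f F a).
  case: F a => [||F] a aU //=.
    by case: pselect => [Da|nDa]; [exact: UG | case: pselect].
  by case: pselect => [aM|naM]; [left; left; exact: fn_univ | case: pselect].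
have fj F a : ~ tuples (fun_ar F) U a -> f F a = junk.
  case: F a => [||F] a naU /=.
  - case: pselect => [Da|nDa]; first by case: naU; exact: MU (Dom_tuples KM Da).
    by case: pselect.
  - by case: naU => -[].
  - case: pselect => [aM|naM]; first by case: naU; exact: MU aM.
    by case: pselect.
pose Ms := @Model (voc_star k lam) U r f Usmall rU fU fj.
have FsE a : Dom E M a -> Fstar Ms a = G a.
  by move=> Da; rewrite /Fstar /=; case: pselect.
exists Ms; split=> //; split=> //.
- by move=> F a aM /=; case: pselect.
- by move=> F a [aU naM] /=; do 2!case: pselect => //.
- by move=> a Da; rewrite FsE //; split; [split; [exact: UG | exact: GM] | exact: Gc].
- by move=> a b Da Db; rewrite !FsE //; exact: GE.
- by move=> a [aU nDa]; rewrite /Fstar /=; do 2!case: pselect => //.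
- move=> b [[Ub nMb] nbc].
  case: Ub => [[Mb|bc]|[a Da Gb]]; [by case: nMb | by case: nbc | ].
  by exists a; rewrite ?FsE.
Qed.


(** * Transport along isomorphisms *)

(** The isomorphism preserves [P_*], hence restricts to the witness, and the
   relation [E] is invariant under isomorphisms. *)
Lemma wit_iso f M N Ms Ns : inK k M -> witness E M Ms -> isomorphism f Ms Ns ->
  isomorphism f M N -> witness E N Ns.
Proof.
move=> KM w fs fM; have KN := aec_iso k_aec KM fM.
have sMs := wit_sub w; have inj := isoI fs.
have inN x : univ Ms x -> univ N (f x) <-> univ M x.
  move=> Msx; split=> [|/(iso_univ fM)//].
  by rewrite -(iso_onto fM) => -[y My /inj <- //]; exact: sMs.
have inNt I a : tuples I (univ Ms) a -> tuples I (univ N) (f \o a) <-> tuples I (univ M) a.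
  by move=> aMs; split=> aN i; apply/inN => //; exact: aN.
have MsP I a : tuples I (univ M) a -> tuples I (univ Ms) a by move=> aM i; exact: sMs.
have DomN a : tuples lam (univ Ms) a -> Dom E N (f \o a) <-> Dom E M a.
  move=> aMs; split=> [Da|Da]; last by apply/(Dom_iso KM fM) => //; exact: Dom_tuples Da.
  have aM : tuples lam (univ M) a by apply/inNt => //; exact: Dom_tuples Da.
  by apply/(Dom_iso KM fM).
have fc : f (cstar Ms) = cstar Ns.
  by rewrite /cstar (iso_fn fs) ?fn_CStar //; case.
have fF a : tuples lam (univ Ms) a -> f (Fstar Ms a) = Fstar Ns (f \o a).
  by move=> aMs; exact: (@iso_fn _ _ _ _ fs (FStar k)).
have domE b : Dom E N b -> exists2 a, Dom E M a & b = f \o a.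
  move=> Db; have [a aM e] := iso_lift fM (Dom_tuples KN Db).
  by exists a => //; apply/(Dom_iso KM fM) => //; rewrite -e.
have DomMs a : Dom E M a -> tuples lam (univ Ms) a by move=> /(Dom_tuples KM)/MsP.
split.
- have PN x : univ Ms x -> Pstar Ns (f x) <-> Pstar Ms x.
    by move=> Msx; apply: iff_sym; exact: (@iso_rel _ _ _ _ fs (PStar k) (fun=> x)).
  apply/seteqP; split=> y.
    by rewrite -(iso_onto fM) => -[x Mx <-]; apply/PN; [exact: sMs | rewrite -(wit_univ w)].
  move=> Py; have := Pstar_univ Py; rewrite -(iso_onto fs) => -[x Msx xy].
  by move: Py; rewrite -xy => /PN; rewrite -(wit_univ w) => Px; apply/inN => //; exact: Px.
- move=> R; apply/seteqP; split=> b Rb.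
    have [a aMs e] := iso_lift fs (rel_univ Rb).
    move: Rb; rewrite e -(iso_rel fs) // (wit_rel w) => Ra.
    by rewrite -(iso_rel fM) //; exact: rel_univ Ra.
  have [a aM e] := iso_lift fM (rel_univ Rb).
  move: Rb; rewrite e -(iso_rel fM) // -(wit_rel w) => Ra.
  by apply/(iso_rel fs) => //; exact: rel_univ Ra.
- move=> F b /(iso_lift fM)[a aM ->].
  by rewrite -(iso_fn fM) // -(wit_fn w) // (@iso_fn _ _ _ _ fs (OldFun F)) //; exact: MsP.
- move=> F b [/(iso_lift fs)[a aMs ->] /(inNt _ _ aMs) naM].
  by rewrite -(@iso_fn _ _ _ _ fs (OldFun F)) // (wit_fn_out w) ?fc.
- by rewrite -fc => /inN; move/(_ (cstar_univ Ms)); exact: (wit_cstar w).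
- move=> _ /domE[a Da ->]; rewrite -fF; last exact: DomMs.
  have MsF := Fstar_univ w Da; split; first split.
  + exact: iso_univ fs MsF.
  + by move=> /(inN _ MsF)/(Fstar_out w Da).
  + by rewrite /= -fc => /(inj _ _ MsF (cstar_univ Ms))/(Fstar_cstar w Da).
- move=> _ _ /domE[a Da ->] /domE[b Db ->]; rewrite -!fF; try exact: DomMs.
  have aM := Dom_tuples KM Da; have bM := Dom_tuples KM Db.
  rewrite -(smooth_iso E_smooth KM fM) // -(wit_Fstar_eq w) //.
  by split=> [/inj|->] //; apply; exact: (Fstar_univ w).
- move=> b [/(iso_lift fs)[a aMs ->] nDb].
  rewrite -fF // (wit_Fstar_out w) ?fc //; split=> // Da.
  by apply: nDb; apply/DomN.
- move=> y [[+ nNy] nyc]; rewrite -(iso_onto fs) => -[x Msx xy].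
  have [a Da xa] : exists2 a, Dom E M a & x = Fstar Ms a.
    apply: (wit_onto w); split; first split=> //.
      by move=> Mx; apply: nNy; rewrite -xy; apply/inN.
    by move=> xc; apply: nyc; rewrite -xy xc.
  exists (f \o a); first by apply/(Dom_iso KM fM) => //; exact: Dom_tuples Da.
  by rewrite -fF ?xa -?xy ?xa //; exact: DomMs.
Qed.

Lemma wit_iso_exists f M Ms Ns : inK k M -> witness E M Ms -> isomorphism f Ms Ns ->
  exists N, [/\ inK k N, isomorphism f M N & witness E N Ns].
Proof.
move=> KM w fs; have [|N fM] := @iso_image _ f M.
  by move=> x y /(wit_sub w) Mx /(wit_sub w) My; exact: isoI fs _ _ Mx My.
by exists N; split=> //; [exact: aec_iso k_aec _ _ _ KM fM | exact: wit_iso KM w fs fM].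
Qed.

(** The extension is forced: it sends [c_*] to [c_*] and the point of the class of
   [a] to the point of the class of [f \o a]. *)
Lemma iso_extend f M N Ms Ns : inK k M -> witness E M Ms -> witness E N Ns ->
  isomorphism f M N -> exists g, [/\ isomorphism g Ms Ns,
    forall x, univ M x -> g x = f x, g (cstar Ms) = cstar Ns &
    forall a, Dom E M a -> g (Fstar Ms a) = Fstar Ns (f \o a)].
Proof.
move=> KM wM wN fM; have KN := aec_iso k_aec KM fM.
have FE a b : Dom E M a -> Dom E M b ->
    Fstar Ms a = Fstar Ms b <-> Fstar Ns (f \o a) = Fstar Ns (f \o b).
  move=> Da Db; have aM := Dom_tuples KM Da; have bM := Dom_tuples KM Db.
  rewrite (wit_Fstar_eq wM) // (wit_Fstar_eq wN); try by apply/(Dom_iso KM fM).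
  exact: smooth_iso.
have /choice[g gP] : forall x, exists y, [/\ univ M x -> y = f x,
    x = cstar Ms -> y = cstar Ns &
    forall a, Dom E M a -> x = Fstar Ms a -> y = Fstar Ns (f \o a)].
  move=> x; have [Mx|nMx] := pselect (univ M x).
    exists (f x); split=> // [xc|a Da xa]; first by case: (wit_cstar wM); rewrite -xc.
    by case: (Fstar_out wM Da); rewrite -xa.
  have [xc|nxc] := pselect (x = cstar Ms).
    by exists (cstar Ns); split=> // a Da; rewrite xc => /esym; case/(Fstar_cstar wM Da).
  have [[a Da xa]|no] := pselect (exists2 a, Dom E M a & x = Fstar Ms a).
    exists (Fstar Ns (f \o a)); split=> // b Db xb.
    by apply/FE => //; rewrite -xa.
  by exists junk; split=> // a Da xa; case: no; exists a.
have gM x : univ M x -> g x = f x by case: (gP x).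
have gc : g (cstar Ms) = cstar Ns by case: (gP (cstar Ms)) => _ ->.
have gF a : Dom E M a -> g (Fstar Ms a) = Fstar Ns (f \o a).
  by move=> Da; case: (gP (Fstar Ms a)) => _ _; exact.
have gMt I a : tuples I (univ M) a -> g \o a = f \o a.
  by move=> aM; apply: funext => i; apply: gM; exact: aM.
have DomN a : Dom E M a -> Dom E N (f \o a).
  by move=> Da; apply/(Dom_iso KM fM) => //; exact: Dom_tuples Da.
have inN x : univ Ms x -> univ N (g x) <-> univ M x.
  move=> /(star_cases wM)[Mx|->|[a Da ->]].
  - by rewrite gM //; split=> // _; exact: iso_univ fM Mx.
  - by rewrite gc; split=> [/(wit_cstar wN)|/(wit_cstar wM)].
  - rewrite gF //; split=> [|/(Fstar_out wM Da)//].
    by move/(Fstar_out wN (DomN _ Da)).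
have isc x : univ Ms x -> g x = cstar Ns <-> x = cstar Ms.
  move=> /(star_cases wM)[Mx|->|[a Da ->]] //.
  - rewrite gM //; split=> e; last by case: (wit_cstar wM); rewrite -e.
    by case: (wit_cstar wN); rewrite -e; exact: iso_univ fM Mx.
  - rewrite gF //; split=> [/(Fstar_cstar wN (DomN _ Da))//|/(Fstar_cstar wM Da)//].
have inNt I a : tuples I (univ Ms) a -> tuples I (univ N) (g \o a) <-> tuples I (univ M) a.
  by move=> aMs; split=> aN i; apply/inN => //; exact: aN.
have gNs x : univ Ms x -> univ Ns (g x).
  move=> /(star_cases wM)[Mx|->|[a Da ->]].
  - by rewrite gM //; apply: (wit_sub wN); exact: iso_univ fM Mx.
  - by rewrite gc; exact: cstar_univ.
  - by rewrite gF //; exact: (Fstar_univ wN (DomN _ Da)).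
have DomM a : tuples lam (univ Ms) a -> Dom E N (g \o a) <-> Dom E M a.
  move=> aMs; split=> Da; last by rewrite gMt; [exact: DomN | exact: Dom_tuples Da].
  have aM : tuples lam (univ M) a by apply/inNt => //; exact: Dom_tuples Da.
  by apply/(Dom_iso KM fM) => //; rewrite -(gMt _ _ aM).
exists g; split=> //; split.
- move=> x y /set_mem Mx /set_mem My gxy.
  case: (star_cases wM Mx) => [Nx|xc|[a Da xa]].
  + have Ny : univ M y by apply/inN => //; rewrite -gxy; apply/inN.
    by apply: (isoI fM) => //; rewrite -!gM.
  + by rewrite xc; apply: esym; apply/isc => //; rewrite -gxy xc.
  + case: (star_cases wM My) => [Ny|yc|[b Db yb]].
    * have : univ M x by apply/inN => //; rewrite gxy; apply/inN.
      by rewrite xa => /(Fstar_out wM Da).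
    * by rewrite yc; apply/isc => //; rewrite gxy yc.
    * by rewrite xa yb; apply/FE => //; rewrite -!gF // -xa -yb.
- apply/seteqP; split=> [_ [x Mx <-]|y]; first exact: gNs.
  move=> /(star_cases wN)[|->|[b Db ->]].
  + rewrite -(iso_onto fM) => -[x Mx <-].
    by exists x; [exact: wit_sub wM _ Mx | exact: gM].
  + by exists (cstar Ms); first exact: cstar_univ.
  + have [a aM e] := iso_lift fM (Dom_tuples KN Db).
    have Da : Dom E M a by apply/(Dom_iso KM fM) => //; rewrite -e.
    by exists (Fstar Ms a); [exact: (Fstar_univ wM Da) | rewrite gF // e].
- case=> [|R] a aMs.
    by rewrite !rel_PStar -(wit_univ wM) -(wit_univ wN) inN //; exact: aMs.
  rewrite (wit_rel wM) (wit_rel wN); split=> Ra.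
    have aM := rel_univ Ra; rewrite (gMt _ _ aM).
    by apply/(iso_rel fM).
  have aM : tuples _ (univ M) a by apply/inNt => //; exact: rel_univ Ra.
  by apply/(iso_rel fM) => //; rewrite -(gMt _ _ aM).
- case=> [||F] a aMs.
  + rewrite -!/(Fstar _ _); have [Da|nDa] := pselect (Dom E M a).
      by rewrite gF // (gMt _ _ (Dom_tuples KM Da)).
    rewrite (wit_Fstar_out wM) // (wit_Fstar_out wN) //.
    by split=> [i|/(DomM _ aMs)//]; exact: gNs.
  + by rewrite !fn_CStar.
  + have [aM|naM] := pselect (tuples (fun_ar F) (univ M) a).
      rewrite (wit_fn wM) // gM; last exact: fn_univ.
      rewrite (gMt _ _ aM) (wit_fn wN) ?(iso_fn fM) //.
      exact: iso_tuples fM aM.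
    rewrite (wit_fn_out wM) // (wit_fn_out wN) //.
    by split=> [i|/(inNt _ _ aMs)//]; exact: gNs.
Qed.

(** * The order and small submodels *)

Local Notation "Ms <=* Ns" := (@leK (class_star E) Ms Ns) (at level 70).

Lemma star_leI M N Ms Ns : witness E M Ms -> witness E N Ns -> leK M N ->
  submodel Ms Ns -> Ms <=* Ns.
Proof.
move=> wM wN MN sMN; split=> //; exists M, N; split=> //; exact: (aec_le_inK k_aec MN).
Qed.

Lemma star_leE M N Ms Ns : witness E M Ms -> witness E N Ns -> Ms <=* Ns -> leK M N.
Proof.
move=> wM wN [_ [M' [N' [_ wM' wN']]]].
by rewrite (wit_unique wM wM') (wit_unique wN wN').
Qed.

Lemma submodel_cstar Ms Ns : submodel Ms Ns -> cstar Ms = cstar Ns.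
Proof. by move=> [_ _ fMN]; apply: fMN => -[]. Qed.

Lemma submodel_Fstar Ms Ns a : submodel Ms Ns -> tuples lam (univ Ms) a ->
  Fstar Ms a = Fstar Ns a.
Proof. by move=> [_ _ fMN] aM; exact: (fMN (FStar k)). Qed.

Lemma submodel_Pstar Ms Ns x : submodel Ms Ns -> univ Ms x -> Pstar Ms x <-> Pstar Ns x.
Proof. by move=> [_ rMN _] Mx; exact: (rMN (PStar k)). Qed.

Lemma star_restrict M N Ns : leK M N -> witness E N Ns ->
  exists Ms, [/\ witness E M Ms, Ms <=* Ns, cstar Ms = cstar Ns &
    forall a, Dom E M a -> Fstar Ms a = Fstar Ns a].
Proof.
move=> MN wN; have [KM KN] := aec_le_inK k_aec MN.
have [uMN _ _] := aec_le_sub k_aec MN.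
have DMN a : Dom E M a -> Dom E N a := Dom_mono MN.
have [||||Ms [wM ec eF]] := @star_exists M (cstar Ns) (@Fstar k lam Ns) KM.
- by move=> /uMN; exact: (wit_cstar wN).
- by move=> a /DMN Da /uMN; exact: (Fstar_out wN Da).
- by move=> a /DMN Da; exact: (Fstar_cstar wN Da).
- move=> a b Da Db; rewrite (wit_Fstar_eq wN); try exact: DMN.
  by apply: (E_le MN); apply: Dom_tuples.
exists Ms; split=> //; apply: (star_leI wM wN MN).
exact: star_submodel wM wN MN ec eF.
Qed.

(** The tuples that represent, in the domain of the relation, the points of [A]
   outside [P_*] have length [lam], so that adding their entries to [A] keeps its
   size below [lam + A]. *)
Lemma star_LS (A : set V) Ns : inK (class_star E) Ns -> A `<=` univ Ns ->
  exists Ms, [/\ A `<=` univ Ms, Ms <=* Ns & univ Ms #<= [set: (lam + A)%type]].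
Proof.
move=> [N KN wN] AN; set X := (lam + A)%type.
have Xinf : infinite_set [set: X].
  apply/infiniteP; apply: (@card_le_trans _ _ _ [set: lam]); first exact/infiniteP.
  by apply: (@card_le_fun _ _ _ _ inl) => // x y _ _ [].
have lamX : [set: lam] #<= [set: X].
  by apply: (@card_le_fun _ _ _ _ inl) => // x y _ _ [].
have AX : A #<= [set: X].
  apply: (@card_le_rel _ _ _ _ (fun x z => if z is inr y then x = set_val y else False)).
    by move=> x Ax; exists (inr (SigSub (mem_set Ax))).
  by move=> x x' [//|y] -> ->.
have /choice[s sP] : forall b, exists a : lam -> V,
    (exists2 a', Dom E N a' & b = Fstar Ns a') -> Dom E N a /\ b = Fstar Ns a.
  move=> b; have [[a Da ->]|no] := pselect (exists2 a', Dom E N a' & b = Fstar Ns a').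
    by exists a.
  by exists (fun=> junk).
pose A0 := (A `&` univ N) `|`
  ([set s p.1 p.2 | p in A `*` [set: lam]] `&` univ N).
have [|M [A0M MN cM]] := aec_LS k_aec (A := A0) KN; first by move=> x [[]|[]].
have KM : inK k M by case: (aec_le_inK k_aec MN).
have [Ms [wM lMN ec eF]] := star_restrict MN wN.
exists Ms; split=> // [x Ax|].
  have [Nx|->|ex] := star_cases wN (AN _ Ax).
  - by apply: (wit_sub wM); apply: A0M; left.
  - by rewrite -ec; exact: cstar_univ.
  - have [Ds ->] := sP _ ex.
    have sM : tuples lam (univ M) (s x).
      move=> i; apply: A0M; right; split; first by exists (x, i).
      exact: Dom_tuples Ds i.
    have DsM : Dom E M (s x) by apply/(Dom_le MN).
    by rewrite -eF //; exact: (Fstar_univ wM).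
apply: card_le_trans (card_star KM wM) _; apply: card_le_trans cM _.
have A0X : A0 #<= [set: X].
  apply: card_le_setU => //.
    by apply: card_le_trans AX; apply: subset_card_le => x [].
  apply: (@card_le_trans _ _ _ [set s p.1 p.2 | p in A `*` [set: lam]]).
    by apply: subset_card_le => x [].
  by apply: card_le_trans (card_image_le _ _) _; exact: card_le_setX.
apply: (@card_le_trans _ _ _ (range inl `|` range inr)).
  by apply: subset_card_le => -[x|x] _; [left|right]; exists x.
apply: card_le_setU => //; first exact: card_le_trans (card_image_le _ _) lamX.
apply: card_le_trans (card_image_le _ _) _; apply: card_le_trans A0X.
by have := card_setT A0; rewrite card_eq_le => /andP[].
Qed.

Lemma below_le T U (A : set T) (B : set U) : A #<= B -> below B mu -> below A mu.
Proof.
case: mu => [m|//] AB [Bm mB]; split; first exact: card_le_trans AB Bm.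
by move=> mA; apply: mB; exact: card_le_trans mA AB.
Qed.

(** * Unions of increasing sequences *)

Section Union.
Variable d : limit_ordinal.

Lemma ord_above2 (i j : ord d) : exists l, olt i l /\ olt j l.
Proof.
have [l il] := ord_nomax i; have [m jm] := ord_nomax j.
have [lm|[e|ml]] := olt_total l m.
- by exists m; split=> //; exact: olt_trans il lm.
- by exists l; rewrite {2}e.
- by exists l; split=> //; exact: olt_trans jm ml.
Qed.

Definition initial_segment (i : ord d) (lim : limit_element i) : limit_ordinal.
Proof.
apply: (@LimitOrdinal {j : ord d | olt j i} (fun j l => olt (sval j) (sval l))).
- move=> j; have := olt_wf (sval j); move: {-1}(sval j) (erefl (sval j)) => x + wx.
  elim: wx j => {}x _ IH j jx; constructor => l lj.
  by apply: (IH (sval l)) => //; rewrite -jx.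
- by move=> j l m; exact: olt_trans.
- move=> [j ji] [l li] /=; have [jl|[jl|lj]] := olt_total j l; [by left| |by right; right].
  by right; left; subst l; congr exist; exact: Prop_irrelevance.
- by case: lim => -[j ji] _; split; exists j.
- move=> [j ji]; have [l jl li] := lim.2 _ ji.
  by exists (exist _ l li).
Defined.

Variable M : ord d -> model (voc k).
Hypothesis incM : increasing M.

(** Replacing the models of limit index by the unions of what precedes them makes
   the sequence continuous. *)
Lemma continuous_refinement N : is_union [set: ord d] M N ->
  exists M' : ord d -> model (voc k), increasing_continuous M' N /\ forall i, leK (M' i) (M i).
Proof.
move=> [KN uN MN].
have KM i : inK k (M i) by case: (aec_le_inK k_aec (MN i I)).
have [_ belowN] := aec_card k_aec KN.
have /choice[M' M'P] : forall i, exists M'i,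
    (limit_element i -> is_union [set j | olt j i] M M'i) /\ leK M'i (M i) /\
    (~ limit_element i -> M'i = M i).
  move=> i; have [lim|nlim] := pselect (limit_element i); last first.
    by exists (M i); split=> //; split=> //; exact: (aec_refl k_aec (KM i)).
  pose Mi (j : ord (initial_segment lim)) := M (sval j).
  have incMi : increasing Mi by move=> j l jl; exact: incM.
  have uMi : \bigcup_j univ (Mi j) = \bigcup_(j in [set j | olt j i]) univ (M j).
    apply/seteqP; split=> x.
      by move=> [[j ji] _ Mx]; exists j.
    by move=> [j ji Mx]; exists (exist _ j ji).
  have bMi : below (\bigcup_j univ (Mi j)) mu.
    apply: below_le belowN; apply: subset_card_le; rewrite uMi uN.
    by move=> x [j _ Mx]; exists j.
  have [P [[KP uP MP] _]] := aec_union k_aec incMi bMi.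
  exists P; split.
    by move=> _; split=> // [|j ji]; [rewrite uP | exact: (MP (exist _ j ji))].
  split=> //; apply: (aec_union_le k_aec incMi bMi); first by split.
  by move=> [j ji]; exact: incM.
have M'M i : leK (M' i) (M i) by case: (M'P i) => _ [].
have trans := aec_trans k_aec.
have MM' i j : olt i j -> leK (M i) (M' j).
  move=> ij; have [lim|nlim] := pselect (limit_element j).
    by have [/(_ lim)[_ _ MMj] _] := M'P j; exact: MMj.
  by have [_ [_ ->]] := M'P j; [exact: incM | ].
have sub' i : univ (M' i) `<=` univ (M i) by case: (aec_le_sub k_aec (M'M i)).
exists M'; split=> //; split.
- by move=> i j ij; exact: trans (M'M i) (MM' _ _ ij).
- by move=> i; exact: trans (M'M i) (MN i I).
- move=> i lim; have [/(_ lim)[KMi ui Mi] _] := M'P i; split=> // [|j ji].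
    rewrite ui; apply/seteqP; split=> x [j ji jx].
      have [l jl li] := lim.2 _ ji; exists l => //.
      by have [sub _ _] := aec_le_sub k_aec (MM' _ _ jl); exact: sub.
    by exists j => //; exact: sub'.
  exact: trans (M'M j) (Mi j ji).
- split=> // [|i _]; last exact: trans (M'M i) (MN i I).
  rewrite uN; apply/seteqP; split=> x [j _ jx]; last by exists j => //; exact: sub'.
  have [l jl] := ord_nomax j; exists l => //.
  by have [sub _ _] := aec_le_sub k_aec (MM' _ _ jl); exact: sub.
Qed.

(** Smoothness, which only speaks of continuous sequences, extends to increasing
   ones. *)
Lemma union_class N a : is_union [set: ord d] M N -> Dom E N a ->
  exists i b, Dom E (M i) b /\ E N a b.
Proof.
move=> uN Da; have [KN _ _] := uN.
have [M' [contM' M'M]] := continuous_refinement uN.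
have : [set eqclass E N a | a in Dom E N] (eqclass E N a) by exists a.
rewrite (smooth_cont E_smooth contM') => -[b [i _ Db] eb].
exists i, b; split; first exact: Dom_mono (M'M i) Db.
apply: (smooth_sym E_smooth KN).
rewrite -[E N b a]/(eqclass E N b a) eb.
exact: smooth_refl.
Qed.

Variable Ms : ord d -> model (voc_star k lam).
Hypothesis wMs : forall i, witness E (M i) (Ms i).
Hypothesis incMs : forall i j, olt i j -> Ms i <=* Ms j.

(** Being in [P_*] does not depend on the member of the sequence, so the [P_*] of
   the union is the union of the sets [P_*]. *)
Lemma star_union_witness N Ns : @is_union (class_star E) _ [set: ord d] Ms Ns ->
  inK k N -> witness E N Ns -> is_union [set: ord d] M N.
Proof.
move=> [_ uNs MNs] KN wN.
have sMNs i : submodel (Ms i) Ns by case: (MNs i I).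
split=> // [|i _]; last exact: star_leE (wMs i) wN (MNs i I).
rewrite (wit_univ wN); apply/seteqP; split=> x.
  move=> Px; have := Pstar_univ Px; rewrite uNs => -[i _ ix]; exists i => //.
  by rewrite (wit_univ (wMs i)); apply/(submodel_Pstar (sMNs i)).
move=> [i _]; rewrite (wit_univ (wMs i)) => Px.
by apply/(submodel_Pstar (sMNs i)) => //; exact: Pstar_univ.
Qed.

(** The values of [F_*] on the tuples of [N] are determined by the sequence, as each
   class of [E N] meets some [M i].  With [N = P] this gives the uniqueness of
   unions, with [P] arbitrary their minimality. *)
Lemma star_union_submodel N Ns P Ps : is_union [set: ord d] M N -> leK N P ->
  witness E N Ns -> witness E P Ps ->
  (forall i, submodel (Ms i) Ns) -> (forall i, submodel (Ms i) Ps) -> submodel Ns Ps.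
Proof.
move=> uN NP wN wP sN sP; have [KN _ MN] := uN; have [_ KP] := aec_le_inK k_aec NP.
apply: (star_submodel wN wP NP).
  have [i] := ord_nonempty d.
  by rewrite -(submodel_cstar (sN i)) (submodel_cstar (sP i)).
move=> a Da; have [i [b [Db Eab]]] := union_class uN Da.
have KMi : inK k (M i) by case: (aec_le_inK k_aec (MN i I)).
have bMs : tuples lam (univ (Ms i)) b.
  by move=> l; apply: (wit_sub (wMs i)); exact: Dom_tuples Db l.
have DbN := Dom_mono (MN i I) Db.
have -> : Fstar Ns a = Fstar Ns b by apply/(wit_Fstar_eq wN).
have -> : Fstar Ps a = Fstar Ps b.
  apply/(wit_Fstar_eq wP); try exact: Dom_mono NP _.
  by apply/(E_le NP) => //; exact: Dom_tuples.
by rewrite -(submodel_Fstar (sN i)) // (submodel_Fstar (sP i)).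
Qed.

(** A class of [E N] receives the point that it has in the expansion of any [M i]
   that it meets; two choices of [i] are compared above both. *)
Lemma star_union_exists N : is_union [set: ord d] M N ->
  exists2 Ns, witness E N Ns & @is_union (class_star E) _ [set: ord d] Ms Ns.
Proof.
move=> uMN; have [KN uN MN] := uMN; have [i0] := ord_nonempty d.
have KM i : inK k (M i) by case: (aec_le_inK k_aec (MN i I)).
have sMs i j : olt i j -> submodel (Ms i) (Ms j) by move=> /incMs[].
have Msub i j : olt i j -> univ (M i) `<=` univ (M j).
  by move=> /incM/(aec_le_sub k_aec)[].
have ec i j : cstar (Ms i) = cstar (Ms j).
  have [l [il jl]] := ord_above2 i j.
  by rewrite (submodel_cstar (sMs _ _ il)) (submodel_cstar (sMs _ _ jl)).
have eF i j b : olt i j -> Dom E (M i) b -> Fstar (Ms i) b = Fstar (Ms j) b.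
  move=> ij Db; apply: submodel_Fstar (sMs _ _ ij) _ => l.
  by apply: (wit_sub (wMs i)); exact: Dom_tuples Db l.
have Dup i j b : olt i j -> Dom E (M i) b -> Dom E (M j) b.
  by move=> ij; exact: Dom_mono (incM ij).
have /choice[G GP] : forall a, exists y, Dom E N a ->
    exists i b, [/\ Dom E (M i) b, E N a b & y = Fstar (Ms i) b].
  move=> a; have [Da|nDa] := pselect (Dom E N a); last by exists junk.
  have [i [b [Db Eab]]] := union_class uMN Da.
  by exists (Fstar (Ms i) b) => _; exists i, b.
(* The point [G a] does not depend on the choice made in [GP]. *)
have GE i a b : Dom E (M i) b -> Dom E N a -> G a = Fstar (Ms i) b <-> E N a b.
  move=> Db Da; have [j [a' [Da' Eaa' ->]]] := GP _ Da.
  have [l [il jl]] := ord_above2 i j.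
  have Dbl := Dup _ _ _ il Db; have Dal := Dup _ _ _ jl Da'.
  rewrite (eF _ _ _ jl) // (eF _ _ _ il) // (wit_Fstar_eq (wMs l)) //.
  rewrite -(E_le (MN l I)); try exact: Dom_tuples.
  split=> [|Eab]; first exact: (smooth_trans E_smooth KN Eaa').
  by apply: (smooth_trans E_smooth KN) Eab; exact: smooth_sym.
have [||||Ns [wN ecN eFN]] := @star_exists N (cstar (Ms i0)) G KN.
- by rewrite uN => -[i _]; rewrite (ec _ i); exact: (wit_cstar (wMs i)).
- move=> a Da; have [i [b [Db _ ->]]] := GP _ Da; rewrite uN => -[j _ jF].
  have [l [il jl]] := ord_above2 i j.
  move: jF; rewrite (eF _ _ _ il) // => /(Msub _ _ jl).
  by apply: (Fstar_out (wMs l)); exact: Dup il Db.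
- move=> a Da; have [i [b [Db _ ->]]] := GP _ Da.
  by rewrite (ec _ i); exact: (Fstar_cstar (wMs i)).
- move=> a b Da Db; have [i [b' [Db' Ebb' ->]]] := GP _ Db; rewrite GE //.
  split=> [Eab'|Eab]; last exact: (smooth_trans E_smooth KN Eab).
  by apply: (smooth_trans E_smooth KN Eab'); exact: smooth_sym.
have MsNs i : Ms i <=* Ns.
  apply: (star_leI (wMs i) wN (MN i I)); apply: (star_submodel (wMs i) wN (MN i I)).
    by rewrite ecN.
  move=> a Da; have DaN := Dom_mono (MN i I) Da; rewrite eFN //; apply: esym.
  by apply/GE => //; exact: smooth_refl.
exists Ns => //; split=> //; first by exists N.
apply/seteqP; split=> x; last by move=> [i _]; have [[sub _ _] _] := MsNs i; exact: sub.
move=> /(star_cases wN)[|->|[a Da ->]].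
- by rewrite uN => -[i _ ix]; exists i => //; exact: wit_sub (wMs i) _ ix.
- by rewrite ecN; exists i0 => //; exact: cstar_univ.
- rewrite eFN //; have [i [b [Db _ ->]]] := GP _ Da.
  by exists i => //; exact: (Fstar_univ (wMs i)).
Qed.

End Union.

(** * Amalgamation *)

Lemma star_expand M : inK k M -> exists Ms, witness E M Ms.
Proof.
move=> KM; have [X MX] := univ_small M.
have [g ginj gM] := fresh_points (option X) (univ_small M).
have [noDom|/existsNP[a0 /contrapT Da0]] := pselect (forall a, ~ Dom E M a).
  have [||||Ms [wM _ _]] := @star_exists M (g None) (fun=> junk) KM; last by exists Ms.
  - exact: gM.
  - by move=> a /noDom.
  - by move=> a /noDom.
  - by move=> a b /noDom.
have [x0] : inhabited X.
  have /card_leP[i] := card_le_trans (E_small KM) MX.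
  by split; apply: set_val (i (SigSub (mem_set _))); last by exists a0.
have [i _ iinj] := card_leE x0 (card_le_trans (E_small KM) MX).
have Ecls a : Dom E M a -> [set eqclass E M a | a in Dom E M] (eqclass E M a).
  by move=> Da; exists a.
have [||||Ms [wM _ _]] :=
  @star_exists M (g None) (fun a => g (Some (i (eqclass E M a)))) KM; last by exists Ms.
- exact: gM.
- by move=> a _; exact: gM.
- by move=> a _ /ginj.
- move=> a b Da Db; rewrite -eqclass_eq //; split=> [/ginj[/iinj e]|-> //].
  by apply: e; exact: Ecls.
Qed.

Lemma star_embedding f M N Ms Ns : inK k M -> witness E M Ms -> witness E N Ns ->
  embedding f M N -> exists g, [/\ @embedding (class_star E) g Ms Ns,
    forall x, univ M x -> g x = f x, g (cstar Ms) = cstar Ns &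
    forall a, Dom E M a -> g (Fstar Ms a) = Fstar Ns (f \o a)].
Proof.
move=> KM wM wN [M' fM M'N].
have [Ms' [wM' lMN ec eF]] := star_restrict M'N wN.
have [g [gM gf gc gF]] := iso_extend KM wM wM' fM.
exists g; split=> //; [by exists Ms' | by rewrite gc|].
move=> a Da; rewrite gF // eF //; apply/(Dom_iso KM fM) => //; exact: Dom_tuples Da.
Qed.

Lemma star_amalgamation : amalgamation k -> amalgamation (class_star E).
Proof.
move=> amal M0s M1s M2s le1 le2.
have [s1 [M0 [M1 [[KM0 KM1] w0 w1 M01]]]] := le1.
have [s2 [M0' [M2 [[_ KM2] w0' w2 M02]]]] := le2.
rewrite -(wit_unique w0 w0') {M0' w0'} in M02.
have [M3 [f1 [f2 [KM3 emb1 emb2 f12]]]] := amal _ _ _ M01 M02.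
have [M3s w3] := star_expand KM3.
have [g1 [gemb1 g1f g1c g1F]] := star_embedding KM1 w1 w3 emb1.
have [g2 [gemb2 g2f g2c g2F]] := star_embedding KM2 w2 w3 emb2.
exists M3s, g1, g2; split=> //; first by exists M3.
have [u1 _ _] := aec_le_sub k_aec M01; have [u2 _ _] := aec_le_sub k_aec M02.
move=> x /(star_cases w0)[Mx|->|[a Da ->]].
- by rewrite g1f ?g2f ?f12 //; [exact: u2 | exact: u1].
- by rewrite {1}(submodel_cstar s1) (submodel_cstar s2) g1c g2c.
have aM := Dom_tuples KM0 Da.
have aMs : tuples lam (univ M0s) a by move=> i; exact: (wit_sub w0 (aM i)).
rewrite {1}(submodel_Fstar s1) // (submodel_Fstar s2) //.
rewrite g1F ?g2F; [|exact: Dom_mono M02 Da|exact: Dom_mono M01 Da].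
by congr (Fstar M3s); apply: funext => i; apply: f12; exact: aM.
Qed.

(** * The axioms *)

Lemma star_le_iso f M1s N1s M2s N2s : submodel M2s N2s ->
  isomorphism f N1s N2s -> isomorphism f M1s M2s -> M1s <=* N1s -> M2s <=* N2s.
Proof.
move=> s2 fN fM [s1 [M1 [N1 [[KM1 KN1] wM1 wN1 le1]]]].
have [M2 [KM2 fM' wM2]] := wit_iso_exists KM1 wM1 fM.
have [N2 [KN2 fN' wN2]] := wit_iso_exists KN1 wN1 fN.
have sMN1 := aec_le_sub k_aec le1; have sMN2 := iso_submodel sMN1 fN' fM'.
by apply: (star_leI wM2 wN2 _ s2); apply/(aec_le_iso k_aec sMN1 sMN2 fN' fM').
Qed.

Lemma star_sequence (d : limit_ordinal) (Ms : ord d -> model (voc_star k lam)) :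
  @increasing (class_star E) d Ms -> exists M : ord d -> model (voc k),
  [/\ increasing M, forall i, inK k (M i) & forall i, witness E (M i) (Ms i)].
Proof.
move=> incMs.
have /choice[M MP] : forall i, exists Mi, inK k Mi /\ witness E Mi (Ms i).
  move=> i; have [j /incMs[_ [Mi [Mj [[KMi _] wi _ _]]]]] := ord_nomax i.
  by exists Mi.
exists M; split=> [i j ij|i|i]; try by case: (MP i).
by have [_ wi] := MP i; have [_ wj] := MP j; exact: star_leE wi wj (incMs _ _ ij).
Qed.

Lemma below_star_sequence (d : limit_ordinal) (M : ord d -> model (voc k))
    (Ms : ord d -> model (voc_star k lam)) : (forall i, witness E (M i) (Ms i)) ->
  below (\bigcup_i univ (Ms i)) mu -> below (\bigcup_i univ (M i)) mu.
Proof.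
move=> w; apply: below_le; apply: subset_card_le => x [i _ Mx].
by exists i => //; exact: (wit_sub (w i)).
Qed.

Lemma star_ess_aec : ess_aec (class_star E) lam mu.
Proof.
have [l0 _] := infinite_setN0 lam_infinite; split.
- case=> [|R]; last exact: (aec_pred_ar k_aec).
  by apply: (@card_le_fun _ _ _ _ (fun=> l0)) => // -[] [].
- case=> [||F] /=; [exact: card_lexx | | exact: (aec_fun_ar k_aec)].
  by apply: (@card_le_fun _ _ _ _ (fun=> l0)) => // -[].
- by move=> Ms Ns [_ [M [N [[KM KN] wM wN _]]]]; split; [exists M|exists N].
- by move=> Ms Ns [].
- move=> f Ms Ns [M KM w] fs; have [N [KN _ wN]] := wit_iso_exists KM w fs.
  by exists N.
- move=> f M1 N1 M2 N2 s1 s2 fN fM; split; first exact: star_le_iso s2 fN fM.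
  have [g gf] : exists g, {in univ N1, cancel f g}.
    have /choice[g gP] : forall y, exists x, forall x', univ N1 x' -> f x' = y -> x = x'.
      move=> y; have [[x [Nx <-]]|no] := pselect (exists x, univ N1 x /\ f x = y).
        by exists x => x' Nx' /(isoI fN) ->.
      by exists y => x' Nx' e; case: no; exists x'.
    by exists g => x /set_mem Nx; exact: gP.
  have gfM : {in univ M1, cancel f g}.
    by move=> x /set_mem Mx; apply: gf; apply: mem_set; exact: (sub_univ s1).
  exact: star_le_iso s1 (iso_inverse gf fN) (iso_inverse gfM fM).
- move=> Ms [M KM w]; have [lamM belowM] := aec_card k_aec KM; split.
    by apply: card_le_trans lamM _; apply: subset_card_le; exact: (wit_sub w).
  exact: below_le (card_star KM w) belowM.
- move=> Ms [M KM w]; apply: (star_leI w w (aec_refl k_aec KM)); exact: submodel_refl.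
- by move=> Ms Ns [sMN _] [sNM _]; exact: submodel_antisym.
- move=> Ms Ns Ps lMN lNP; have [sMN [M [N [_ wM wN MN]]]] := lMN.
  have [sNP [_ [P [_ _ wP _]]]] := lNP.
  apply: (star_leI wM wP); last exact: submodel_trans sMN sNP.
  exact: (aec_trans k_aec MN (star_leE wN wP lNP)).
- move=> d Ms incMs bMs; have [M [incM KM wMs]] := star_sequence incMs.
  have [N [uMN _]] := aec_union k_aec incM (below_star_sequence wMs bMs).
  have [Ns wN uNs] := star_union_exists incM wMs incMs uMN.
  exists Ns; split=> // Ps uPs; have [[P KP wP] _ MPs] := uPs; have [_ _ MNs] := uNs.
  have uMP := star_union_witness wMs uPs KP wP.
  have eNP : N = P.
    have [N' [_ uniq]] := aec_union k_aec incM (below_star_sequence wMs bMs).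
    by rewrite -(uniq _ uMN) (uniq _ uMP).
  subst P; have NN := aec_refl k_aec KP.
  have sN i : submodel (Ms i) Ns by case: (MNs i I).
  have sP i : submodel (Ms i) Ps by case: (MPs i I).
  by apply: submodel_antisym; apply: (star_union_submodel incM wMs uMN NN).
- move=> d Ms Ns Ps incMs bMs uNs MPs; have [M [incM KM wMs]] := star_sequence incMs.
  have [[N KN wN] _ MNs] := uNs; have uMN := star_union_witness wMs uNs KN wN.
  have [i0] := ord_nonempty d.
  have [_ [_ [P [_ _ wP _]]]] := MPs i0.
  have NP : leK N P.
    apply: (aec_union_le k_aec incM (below_star_sequence wMs bMs) uMN).
    by move=> i; exact: star_leE (wMs i) wP (MPs i).
  apply: (star_leI wN wP NP); apply: (star_union_submodel incM wMs uMN NP wN wP) => i.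
    by case: (MNs i I).
  by case: (MPs i).
- move=> M1s M2s Ns s12 l1 l2; have [s1 [M1 [N [_ w1 wN le1]]]] := l1.
  have [s2 [M2 [_ [_ w2 _ _]]]] := l2; have le2 := star_leE w2 wN l2.
  apply: (star_leI w1 w2 _ s12).
  apply: (aec_coherence k_aec _ le1 le2).
  apply: submodel_coherence (aec_le_sub k_aec le1) (aec_le_sub k_aec le2).
  rewrite (wit_univ w1) (wit_univ w2) => x Px.
  by apply/(submodel_Pstar s12) => //; exact: Pstar_univ.
- exact: star_LS.
Qed.

End Star.

Theorem claim2p10 (lam : Small) (mu : option Small)
    (lam_infinite : infinite_set [set: lam]) (lam_lt_mu : below [set: lam] mu)
    (k : ordered_class) (k_aec : ess_aec k lam mu)
    (E : tuple_relation k lam) (E_smooth : smooth E) (E_small : small E) :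
  ess_aec (class_star E) lam mu /\
  (amalgamation k -> amalgamation (class_star E)).
Proof.
by split; [exact: star_ess_aec | exact: star_amalgamation k_aec E_smooth E_small].
Qed.
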